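(* Let $f$ be $\rho$-weakly convex and $r$ be $\eta$-weakly convex on $\mathbb{X}$, so that $\varphi=f+r$ is $(\rho+\eta)$-weakly convex, and let $\varphi_\lambda$ be the Moreau envelope of $\varphi$ with $0<\lambda<\frac{1}{\rho+\eta}$. Then: (i) (B$_{\text{G}}$) $\Longleftrightarrow$ (B$_3$). (ii) (B$_{\text{A-D}}$) $\Longrightarrow$ (B$_2$). Conversely, if $\mathbb{X}^*$ is bounded, then (B$_2$) $\Longrightarrow$ (B$_{\text{A-D}}$). (iii) (B$_{\text{A-D}}$) $\Longrightarrow$ (B$_6$). (iv) (B$_{\text{G}}$) (with constants $c_{11},c_{12}$) $\Longrightarrow$ (B$_{\text{A-D}}$) with $c_9=\sqrt{c_{11}(\rho+\eta+c_{11})}$ and $c_{10}=\sqrt{2c_{12}}$. Conversely, if $\varphi$ satisfies the global quadratic growth property, i.e. there is $\kappa_{gQG}^\varphi>0$ with $\mathrm{dist}^2(x,\mathbb{X}^* )\le\kappa_{gQG}^\varphi[\varphi(x)-\varphi^*]$ for all $x\in\mathbb{X}$, then (B$_{\text{A-D}}$) $\Longrightarrow$ (B$_{\text{G}}$).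
   Context: Setting: $\mathbb{X}\subseteq\mathbb{R}^d$ is closed and convex; $f,r:\mathbb{X}\to\mathbb{R}$ are proper and lower semicontinuous; $\varphi=f+r$; the set $\mathbb{X}^*$ of minimizers of $\varphi$ over $\mathbb{X}$ is non-empty and $\varphi^*$ is the minimum value. A function $u:\mathbb{X}\to\mathbb{R}$ is $\rho$-weakly convex if $\theta=u+\frac{\rho}{2}\|\cdot\|^2$ is convex; then $\partial u(x)=\partial\theta(x)-\rho x$, where $\partial\theta(x)=\{v:\theta(y)\ge\theta(x)+\langle v,y-x\rangle\ \forall y\in\mathbb{X}\}$. Moreau envelope: $\varphi_\lambda(x)=\min_{y\in\mathbb{X}}\{\varphi(y)+\frac{1}{2\lambda}\|y-x\|^2\}$. Conditions (each asserts existence of nonnegative constants such that the bound holds for all $x\in\mathbb{X}$ — except in (B$_6$) — all $g(x)\in\partial f(x)$ and all $h(x)\in\partial r(x)$): (B$_2$) $\|g(x)+h(x)\|\le c_1\|x\|+c_2$; (B$_3$) $\|g(x)+h(x)\|\le\sqrt{c_3[\varphi_\lambda(x)-\varphi^*]+c_4}$; (B$_6$) for some $\gamma>0$ there is $c_8>0$ with $\|g(x)+h(x)\|\le c_8$ for all $x\in\mathcal{T}_\gamma=\{x\in\mathbb{X}\mid\mathrm{dist}(x,\mathbb{X}^* )<\gamma\}$; (B$_{\text{A-D}}$) $\|g(x)+h(x)\|\le c_9\,\mathrm{dist}(x,\mathbb{X}^* )+c_{10}$; (B$_{\text{G}}$) $\|g(x)+h(x)\|\le\sqrt{c_{11}[\varphi(x)-\varphi^*]+c_{12}}$.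 *)

(* Defs.v *)
From mathcomp Require Import all_boot all_order all_algebra.
From mathcomp Require Import all_classical all_reals all_analysis.

Set Implicit Arguments.
Unset Strict Implicit.
Unset Printing Implicit Defensive.

Import Order.TTheory GRing.Theory Num.Theory.
Import numFieldNormedType.Exports.

Local Open Scope classical_set_scope.
Local Open Scope ring_scope.

Definition dotp (R : realType) (d : nat) (u v : 'rV[R]_d) : R :=
  \sum_(i < d) u 0 i * v 0 i.

(* The norm [`|x|] that MathComp-Analysis puts on ['rV[R]_d] is the sup norm,
   hence a separate Euclidean norm; the topologies coincide. *)
Definition enorm (R : realType) (d : nat) (x : 'rV[R]_d) : R :=
  Num.sqrt (dotp x x).

Definition edist (R : realType) (d : nat) (x : 'rV[R]_d)
    (A : set 'rV[R]_d) : R :=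
  inf [set enorm (x - y) | y in A].

(* Functions on a set X are total functions on ['rV[R]_d]; every notion below
   only looks at their values on X. *)

(* Points outside X are isolated in [subspace X], so this is lower
   semicontinuity for the topology induced on X. *)
Definition lsc_on (R : realType) (d : nat) (X : set 'rV[R]_d)
    (u : 'rV[R]_d -> R) : Prop :=
  lower_semicontinuous (fun x : subspace X => (u x)%:E).

Definition regularized (R : realType) (d : nat) (rho : R)
    (u : 'rV[R]_d -> R) (x : 'rV[R]_d) : R :=
  u x + rho / 2 * enorm x ^+ 2.

Definition weakly_convex (R : realType) (d : nat) (X : set 'rV[R]_d) (rho : R)
    (u : 'rV[R]_d -> R) : Prop :=
  convex_function X (regularized rho u).

Definition convex_subdiff (R : realType) (d : nat) (X : set 'rV[R]_d)
    (theta : 'rV[R]_d -> R) (x : 'rV[R]_d) : set 'rV[R]_d :=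
  [set v | forall y, X y -> theta x + dotp v (y - x) <= theta y].

Definition subdiff (R : realType) (d : nat) (X : set 'rV[R]_d) (rho : R)
    (u : 'rV[R]_d -> R) (x : 'rV[R]_d) : set 'rV[R]_d :=
  [set v - rho *: x | v in convex_subdiff X (regularized rho u) x].

Definition minimizers (R : realType) (d : nat) (X : set 'rV[R]_d)
    (phi : 'rV[R]_d -> R) : set 'rV[R]_d :=
  [set x | X x /\ forall y, X y -> phi x <= phi y].

(* [inf] is the minimum whenever the minimum is attained. *)
Definition min_value (R : realType) (d : nat) (X : set 'rV[R]_d)
    (phi : 'rV[R]_d -> R) : R :=
  inf (phi @` X).

Definition moreau_envelope (R : realType) (d : nat) (X : set 'rV[R]_d)
    (lam : R) (phi : 'rV[R]_d -> R) (x : 'rV[R]_d) : R :=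
  min_value X (fun y => phi y + 1 / (2 * lam) * enorm (y - x) ^+ 2).

Definition global_quadratic_growth (R : realType) (d : nat)
    (X : set 'rV[R]_d) (phi : 'rV[R]_d -> R) : Prop :=
  exists kappa : R, 0 < kappa /\
    forall x, X x ->
      edist x (minimizers X phi) ^+ 2 <= kappa * (phi x - min_value X phi).

Definition subgrad_bound (R : realType) (d : nat) (X : set 'rV[R]_d)
    (rho eta : R) (f r : 'rV[R]_d -> R)
    (D : set 'rV[R]_d) (b : 'rV[R]_d -> R) : Prop :=
  forall x, D x -> forall g h,
    subdiff X rho f x g -> subdiff X eta r x h -> enorm (g + h) <= b x.

Definition cond_B2 (R : realType) (d : nat) (X : set 'rV[R]_d)
    (rho eta : R) (f r : 'rV[R]_d -> R) : Prop :=
  exists c1 c2 : R, [/\ 0 <= c1, 0 <= c2 &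
    subgrad_bound X rho eta f r X (fun x => c1 * enorm x + c2)].

Definition cond_B3 (R : realType) (d : nat) (X : set 'rV[R]_d)
    (rho eta lam : R) (f r : 'rV[R]_d -> R) : Prop :=
  exists c3 c4 : R, [/\ 0 <= c3, 0 <= c4 &
    subgrad_bound X rho eta f r X (fun x => Num.sqrt
      (c3 * (moreau_envelope X lam (f \+ r) x - min_value X (f \+ r)) + c4))].

Definition cond_B6 (R : realType) (d : nat) (X : set 'rV[R]_d)
    (rho eta : R) (f r : 'rV[R]_d -> R) : Prop :=
  exists gamma c8 : R, [/\ 0 < gamma, 0 < c8 &
    subgrad_bound X rho eta f r
      [set x | X x /\ edist x (minimizers X (f \+ r)) < gamma] (fun=> c8)].

Definition cond_BAD_with (R : realType) (d : nat) (X : set 'rV[R]_d)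
    (rho eta : R) (f r : 'rV[R]_d -> R) (c9 c10 : R) : Prop :=
  [/\ 0 <= c9, 0 <= c10 &
    subgrad_bound X rho eta f r X
      (fun x => c9 * edist x (minimizers X (f \+ r)) + c10)].

Definition cond_BAD (R : realType) (d : nat) (X : set 'rV[R]_d)
    (rho eta : R) (f r : 'rV[R]_d -> R) : Prop :=
  exists c9 c10 : R, cond_BAD_with X rho eta f r c9 c10.

Definition cond_BG_with (R : realType) (d : nat) (X : set 'rV[R]_d)
    (rho eta : R) (f r : 'rV[R]_d -> R) (c11 c12 : R) : Prop :=
  [/\ 0 <= c11, 0 <= c12 &
    subgrad_bound X rho eta f r X (fun x => Num.sqrt
      (c11 * ((f \+ r) x - min_value X (f \+ r)) + c12))].

Definition cond_BG (R : realType) (d : nat) (X : set 'rV[R]_d)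
    (rho eta : R) (f r : 'rV[R]_d -> R) : Prop :=
  exists c11 c12 : R, cond_BG_with X rho eta f r c11 c12.

(* Main.v *)
Require Import Defs.
From mathcomp Require Import all_boot all_order all_algebra.
From mathcomp Require Import all_classical all_reals all_analysis.
From mathcomp Require Import ring lra.
Import Order.TTheory GRing.Theory Num.Theory.
Import numFieldNormedType.Exports.
(* Analysis has its own [edist], which would otherwise shadow that of [Defs]. *)
Import Defs.
Local Open Scope classical_set_scope.
Local Open Scope ring_scope.

Set Implicit Arguments.
Unset Strict Implicit.

(** Put [s = rho + eta], which is nonnegative. A sum [v] of subgradients of [f]
    and [r] at [x] satisfies
    [phi x <= phi y + |v| |x - y| + s / 2 |x - y|^2] for every [y] in [X].
    Writing [A = c11 (phi x - phi^* ) + c12 >= |v|^2] and absorbing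
    [c11 |v| |x - y| <= A / 2 + c11^2 |x - y|^2 / 2] gives
    [A <= 2 c11 (phi y - phi^* ) + c11 (s + c11) |x - y|^2 + 2 c12].
    Restricting [y] to minimizers yields (B_A-D), and taking the infimum over
    all [y] yields (B_3); neither the existence of proximal points nor that of
    projections is needed. *)

(** * Euclidean inner product and norm *)

Lemma dotpC (R : realType) (d : nat) (u v : 'rV[R]_d) : dotp u v = dotp v u.
Proof. by apply: eq_bigr => i _; rewrite mulrC. Qed.

Lemma dotpDl (R : realType) (d : nat) (u v w : 'rV[R]_d) :
  dotp (u + v) w = dotp u w + dotp v w.
Proof. by rewrite -big_split; apply: eq_bigr => i _; rewrite mxE mulrDl. Qed.

Lemma dotpDr (R : realType) (d : nat) (u v w : 'rV[R]_d) :
  dotp u (v + w) = dotp u v + dotp u w.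
Proof. by rewrite !(dotpC u) dotpDl. Qed.

Lemma dotpZl (R : realType) (d : nat) (a : R) (u v : 'rV[R]_d) :
  dotp (a *: u) v = a * dotp u v.
Proof. by rewrite mulr_sumr; apply: eq_bigr => i _; rewrite mxE mulrA. Qed.

Lemma dotpZr (R : realType) (d : nat) (a : R) (u v : 'rV[R]_d) :
  dotp u (a *: v) = a * dotp u v.
Proof. by rewrite !(dotpC u) dotpZl. Qed.

Lemma dotpNl (R : realType) (d : nat) (u v : 'rV[R]_d) :
  dotp (- u) v = - dotp u v.
Proof. by rewrite -scaleN1r dotpZl mulN1r. Qed.

Lemma dotpNr (R : realType) (d : nat) (u v : 'rV[R]_d) :
  dotp u (- v) = - dotp u v.
Proof. by rewrite !(dotpC u) dotpNl. Qed.

Definition dotpE := (dotpDl, dotpDr, dotpZl, dotpZr, dotpNl, dotpNr).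

Lemma dotp_ge0 (R : realType) (d : nat) (u : 'rV[R]_d) : 0 <= dotp u u.
Proof. by apply: sumr_ge0 => i _; rewrite -expr2 sqr_ge0. Qed.

Lemma sqr_enorm (R : realType) (d : nat) (u : 'rV[R]_d) :
  enorm u ^+ 2 = dotp u u.
Proof. by rewrite sqr_sqrtr ?dotp_ge0. Qed.

Lemma enorm_ge0 (R : realType) (d : nat) (u : 'rV[R]_d) : 0 <= enorm u.
Proof. exact: sqrtr_ge0. Qed.

Lemma enormN (R : realType) (d : nat) (u : 'rV[R]_d) : enorm (- u) = enorm u.
Proof. by rewrite /enorm !dotpE opprK. Qed.

Lemma enorm0_eq0 (R : realType) (d : nat) (u : 'rV[R]_d) :
  enorm u = 0 -> u = 0.
Proof.
move=> u0; have /eqP := sqr_enorm u; rewrite u0 expr0n eq_sym.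
rewrite psumr_eq0 => [/allP u_eq0|i _]; last by rewrite -expr2 sqr_ge0.
apply/rowP => i; rewrite mxE; have /= := u_eq0 i (mem_index_enum i).
by rewrite mulf_eq0 orbb => /eqP.
Qed.

(** Cauchy-Schwarz: expand the square of [enorm v *: u - enorm u *: v] and cancel the factor
    [enorm u * enorm v], once it is known to be positive. *)
Lemma dotp_le_enorm (R : realType) (d : nat) (u v : 'rV[R]_d) :
  dotp u v <= enorm u * enorm v.
Proof.
have [/eqP|uv_neq0] := eqVneq (enorm u * enorm v) 0.
  rewrite mulf_eq0 => /orP[] /eqP /enorm0_eq0 ->; rewrite -(scale0r 0).
    by rewrite dotpZl mul0r mulr_ge0 ?enorm_ge0.
  by rewrite dotpZr mul0r mulr_ge0 ?enorm_ge0.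
have uv_gt0 : 0 < enorm u * enorm v.
  by rewrite lt_neqAle eq_sym uv_neq0 mulr_ge0 ?enorm_ge0.
have := dotp_ge0 (enorm v *: u - enorm u *: v).
rewrite !dotpE (dotpC v u) -!sqr_enorm => sq_ge0.
by rewrite -(ler_pM2l uv_gt0); lra.
Qed.

Lemma ler_enormD (R : realType) (d : nat) (u v : 'rV[R]_d) :
  enorm (u + v) <= enorm u + enorm v.
Proof.
rewrite -(@ler_pXn2r _ 2) ?nnegrE ?addr_ge0 ?enorm_ge0//.
rewrite sqr_enorm !dotpE (dotpC v u) -!sqr_enorm.
by have := dotp_le_enorm u v; nra.
Qed.

Lemma ler_enormB (R : realType) (d : nat) (u v : 'rV[R]_d) :
  enorm (u - v) <= enorm u + enorm v.
Proof. by rewrite (le_trans (ler_enormD _ _))// enormN. Qed.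

(** Each of the [d] squared coordinates is at most the squared sup norm. This turns [bounded_set],
    which refers to the sup norm, into a Euclidean bound. *)
Lemma enorm_le_norm (R : realType) (d : nat) (u : 'rV[R]_d) :
  enorm u <= Num.sqrt d%:R * `|u|.
Proof.
have -> : Num.sqrt d%:R * `|u| = Num.sqrt (d%:R * `|u| ^+ 2).
  by rewrite sqrtrM ?ler0n// sqrtr_sqr normr_id.
apply: ler_wsqrtr; have -> : d%:R * `|u| ^+ 2 = \sum_(i < d) `|u| ^+ 2.
  by rewrite sumr_const card_ord mulr_natl.
apply: ler_sum => i _; rewrite -expr2 -real_normK ?num_real//.
by rewrite lerXn2r ?nnegrE// /Num.norm/= mx_normrE (le_bigmax _ _ (0, i)).
Qed.

(** * Distances, minimum values and Moreau envelopes as infima *)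

Lemma edist_le (R : realType) (d : nat) (x y : 'rV[R]_d) (A : set 'rV[R]_d) :
  A y -> edist x A <= enorm (x - y).
Proof.
move=> Ay; apply: ge_inf; last by exists y.
by exists 0 => _ [z _ <-]; exact: enorm_ge0.
Qed.

Lemma le_edist (R : realType) (d : nat) (x : 'rV[R]_d) (A : set 'rV[R]_d)
    (m : R) :
  A !=set0 -> (forall y, A y -> m <= enorm (x - y)) -> m <= edist x A.
Proof.
move=> [y Ay] mA; apply: lb_le_inf; first by exists (enorm (x - y)), y.
by move=> _ [z Az <-]; exact: mA.
Qed.

Lemma edist_ge0 (R : realType) (d : nat) (x : 'rV[R]_d) (A : set 'rV[R]_d) :
  A !=set0 -> 0 <= edist x A.
Proof. by move=> A0; apply: le_edist => // y _; exact: enorm_ge0. Qed.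

(** Stands in for evaluation at a projection of [x] onto [A]: a bound valid at every point of [A]
    passes to the infimum. The case [a = 0] is separate because the other one divides by [a]. *)
Lemma le_affine_edist (R : realType) (d : nat) (x : 'rV[R]_d)
    (A : set 'rV[R]_d) (m a b : R) :
  A !=set0 -> 0 <= a -> (forall y, A y -> m <= a * enorm (x - y) + b) ->
  m <= a * edist x A + b.
Proof.
move=> A0; rewrite le_eqVlt => /predU1P[<-|a_gt0] mA.
  by have [y /mA] := A0; rewrite !mul0r.
rewrite -lerBlDr mulrC -ler_pdivrMr//; apply: le_edist => // y /mA.
by rewrite ler_pdivrMr// mulrC lerBlDr.
Qed.

Lemma min_value_minimizer (R : realType) (d : nat) (X : set 'rV[R]_d)
    (phi : 'rV[R]_d -> R) (x : 'rV[R]_d) :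
  minimizers X phi x -> min_value X phi = phi x.
Proof.
move=> [Xx phi_ge]; apply/eqP; rewrite eq_le; apply/andP; split.
  by apply: ge_inf; [exists (phi x) => _ [y /phi_ge ? <-]|exists x].
by apply: lb_le_inf; [exists (phi x), x|move=> _ [y /phi_ge ? <-]].
Qed.

Lemma min_value_le (R : realType) (d : nat) (X : set 'rV[R]_d)
    (phi : 'rV[R]_d -> R) (y : 'rV[R]_d) :
  minimizers X phi !=set0 -> X y -> min_value X phi <= phi y.
Proof. by move=> [x /[dup] /min_value_minimizer -> [_ +]] => /[apply]. Qed.

(** The point [y = x] competes in the infimum, and the minimum value of [phi] bounds the competing
    values from below. *)
Lemma moreau_envelope_le (R : realType) (d : nat) (X : set 'rV[R]_d) (lam : R)
    (phi : 'rV[R]_d -> R) (x : 'rV[R]_d) :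
  0 < lam -> minimizers X phi !=set0 -> X x ->
  moreau_envelope X lam phi x <= phi x.
Proof.
move=> lam_gt0 phi_min Xx; apply: ge_inf.
  exists (min_value X phi) => _ [y Xy <-].
  rewrite (le_trans (min_value_le phi_min Xy))// lerDl.
  by rewrite mulr_ge0 ?sqr_ge0// divr_ge0 ?mulr_ge0 ?ltW.
by exists x => //; rewrite subrr sqr_enorm -(scale0r x) dotpZl mul0r mulr0 addr0.
Qed.

Lemma le_moreau_envelope (R : realType) (d : nat) (X : set 'rV[R]_d) (lam : R)
    (phi : 'rV[R]_d -> R) (x : 'rV[R]_d) (m : R) :
  X !=set0 ->
  (forall y, X y -> m <= phi y + 1 / (2 * lam) * enorm (y - x) ^+ 2) ->
  m <= moreau_envelope X lam phi x.
Proof.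
move=> [y Xy] mX; apply: lb_le_inf; first exact: image_nonempty (ex_intro _ y Xy).
by move=> _ [z Xz <-]; exact: mX.
Qed.

(** * Subgradient inequalities under weak convexity *)

Lemma subdiff_le (R : realType) (d : nat) (X : set 'rV[R]_d) (rho : R)
    (u : 'rV[R]_d -> R) (x y g : 'rV[R]_d) :
  subdiff X rho u x g -> X y ->
  u x + dotp g (y - x) - rho / 2 * enorm (y - x) ^+ 2 <= u y.
Proof.
move=> [w + <-] Xy => /(_ y Xy).
(* The terms in [rho] combine by |y|^2 - |x|^2 - 2 <x, y - x> = |y - x|^2. *)
by rewrite /regularized !sqr_enorm !dotpE (dotpC y x); nra.
Qed.

Lemma sum_subdiff_le (R : realType) (d : nat) (X : set 'rV[R]_d) (rho eta : R)
    (f r : 'rV[R]_d -> R) (x y g h : 'rV[R]_d) :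
  subdiff X rho f x g -> subdiff X eta r x h -> X y ->
  (f \+ r) x <= (f \+ r) y + enorm (g + h) * enorm (x - y)
                + (rho + eta) / 2 * enorm (x - y) ^+ 2.
Proof.
move=> /subdiff_le fg /subdiff_le rh Xy; move: (fg y Xy) (rh y Xy).
have := dotp_le_enorm (g + h) (x - y).
by rewrite -(opprB x y) enormN /= dotpDl !dotpNr; lra.
Qed.

(** * Implications between the subgradient bounds *)

Section BoundComparison.
Variables (R : realType) (d : nat) (X : set 'rV[R]_d).
Variables (f r : 'rV[R]_d -> R) (rho eta : R).
Hypothesis argmin_neq0 : minimizers X (f \+ r) !=set0.

Let gap_ge0 x : X x -> 0 <= (f \+ r) x - min_value X (f \+ r).
Proof. by move=> Xx; rewrite subr_ge0 min_value_le. Qed.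

Lemma cond_BG_growth (c11 c12 : R) (x y g h : 'rV[R]_d) :
  cond_BG_with X rho eta f r c11 c12 -> X x -> X y ->
  subdiff X rho f x g -> subdiff X eta r x h ->
  c11 * ((f \+ r) x - min_value X (f \+ r)) + c12 <=
    2 * c11 * ((f \+ r) y - min_value X (f \+ r))
    + c11 * (rho + eta + c11) * enorm (x - y) ^+ 2 + 2 * c12.
Proof.
move=> [c11_ge0 c12_ge0 BG] Xx Xy fg rh.
have A_ge0 := addr_ge0 (mulr_ge0 c11_ge0 (gap_ge0 Xx)) c12_ge0.
have := BG x Xx g h fg rh; have := sqr_sqrtr A_ge0.
have := ler_wpM2l c11_ge0 (sum_subdiff_le fg rh Xy).
set q := Num.sqrt _; set t := enorm (x - y) => growth sq_q n_le_q.
have := ler_wpM2l c11_ge0 (ler_wpM2r (enorm_ge0 (x - y)) n_le_q).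
(* Here [q ^+ 2] is the left-hand side A, so half of it absorbs the cross term [c11 * q * t];
   doubling then gives the claim. *)
by have := sqr_ge0 (q - c11 * t); rewrite -/t; nra.
Qed.

Lemma cond_BG_B3 (lam : R) : 0 < lam -> 0 <= rho + eta ->
  cond_BG X rho eta f r -> cond_B3 X rho eta lam f r.
Proof.
move=> lam_gt0 s_ge0 [c11 [c12 /[dup] BG_with [c11_ge0 c12_ge0 BG]]].
have cs_ge0 := mulr_ge0 c11_ge0 (addr_ge0 s_ge0 c11_ge0).
have lcs_ge0 := mulr_ge0 (ltW lam_gt0) cs_ge0.
(* The first term of [C] pays for the gap at [y], the second for |x - y|^2, which is [2 * lam] times
   the proximal term; the 1 makes [C] positive, hence invertible. *)
pose C := 2 * c11 + 2 * lam * (c11 * (rho + eta + c11)) + 1.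
have C_gt0 : 0 < C by rewrite /C; lra.
exists C, (2 * c12); split=> [||x Xx g h fg rh]; [exact: ltW|lra|].
rewrite (le_trans (BG x Xx g h fg rh))//; apply: ler_wsqrtr.
(* Isolate the envelope, so that the bound can be checked at each competitor [y]; the rearrangement
   is then undone. *)
rewrite -lerBlDr -ler_pdivrMl// lerBrDr.
apply: le_moreau_envelope => [|y Xy]; first by exists x.
rewrite -lerBrDr ler_pdivrMl// lerBlDr.
rewrite (le_trans (cond_BG_growth BG_with Xx Xy fg rh))// lerD2r.
rewrite -(opprB x y) enormN; have := gap_ge0 Xy.
have : enorm (x - y) ^+ 2 = 2 * lam * (1 / (2 * lam) * enorm (x - y) ^+ 2).
  by field; lra.
have : 0 <= 1 / (2 * lam) * enorm (x - y) ^+ 2.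
  by rewrite mulr_ge0 ?sqr_ge0// divr_ge0// mulr_ge0// ltW.
set m := 1 / _ * _ => m_ge0 -> E_ge0; rewrite /C.
have := mulr_ge0 lcs_ge0 E_ge0; have := mulr_ge0 c11_ge0 m_ge0.
nra.
Qed.

Lemma cond_B3_BG (lam : R) : 0 < lam ->
  cond_B3 X rho eta lam f r -> cond_BG X rho eta f r.
Proof.
move=> lam_gt0 [c3 [c4 [c3_ge0 c4_ge0 B3]]].
exists c3, c4; split=> // x Xx g h fg rh.
rewrite (le_trans (B3 x Xx g h fg rh))//; apply: ler_wsqrtr.
by rewrite lerD2r ler_wpM2l// lerD2r moreau_envelope_le.
Qed.

Lemma cond_BAD_B2 : cond_BAD X rho eta f r -> cond_B2 X rho eta f r.
Proof.
move=> [c9 [c10 [c9_ge0 c10_ge0 BAD]]]; have [x0 x0_min] := argmin_neq0.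
(* The distance to the minimizers is at most |x - x0| <= |x| + |x0|. *)
exists c9, (c9 * enorm x0 + c10); split=> //.
  by rewrite addr_ge0 ?mulr_ge0 ?enorm_ge0.
move=> x Xx g h fg rh; rewrite (le_trans (BAD x Xx g h fg rh))//.
rewrite addrA lerD2r -mulrDr ler_wpM2l//.
by rewrite (le_trans (edist_le x x0_min)) ?ler_enormB.
Qed.

Lemma cond_B2_BAD : bounded_set (minimizers X (f \+ r)) ->
  cond_B2 X rho eta f r -> cond_BAD X rho eta f r.
Proof.
move=> [M [_ /(_ (`|M| + 1))]].
(* [bounded_set] only provides bounds strictly above [M]; [|M| + 1] is one, and it is
   nonnegative. *)
rewrite ltr_pwDr ?ler_norm// => /(_ isT) minM.
move=> [c1 [c2 [c1_ge0 c2_ge0 B2]]].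
pose N := Num.sqrt d%:R * (`|M| + 1).
exists c1, (c1 * N + c2); split=> //.
  by rewrite addr_ge0 ?mulr_ge0 ?sqrtr_ge0 ?addr_ge0.
move=> x Xx g h fg rh; rewrite (le_trans (B2 x Xx g h fg rh))//.
(* For each minimizer [y], |x| <= |x - y| + |y| with |y| <= [N]. *)
apply: le_affine_edist => // y y_min; rewrite addrA lerD2r -mulrDr ler_wpM2l//.
rewrite -[x in leLHS](subrK y) (le_trans (ler_enormD _ _))// lerD2l.
by rewrite (le_trans (enorm_le_norm _))// ler_wpM2l ?sqrtr_ge0// minM.
Qed.

Lemma cond_BAD_B6 : cond_BAD X rho eta f r -> cond_B6 X rho eta f r.
Proof.
move=> [c9 [c10 [c9_ge0 c10_ge0 BAD]]].
(* The added 1 keeps [c8] positive even if [c9] and [c10] vanish. *)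
exists 1, (c9 + c10 + 1); split=> //; first by rewrite ltr_wpDl ?addr_ge0.
move=> x [Xx /ltW dx] g h fg rh; rewrite (le_trans (BAD x Xx g h fg rh))//.
by have := ler_wpM2l c9_ge0 dx; lra.
Qed.

Lemma cond_BG_BAD (c11 c12 : R) : 0 <= rho + eta ->
  cond_BG_with X rho eta f r c11 c12 ->
  cond_BAD_with X rho eta f r
    (Num.sqrt (c11 * (rho + eta + c11))) (Num.sqrt (2 * c12)).
Proof.
move=> s_ge0 /[dup] BG_with [c11_ge0 c12_ge0 BG]; split; rewrite ?sqrtr_ge0//.
have cs_ge0 := mulr_ge0 c11_ge0 (addr_ge0 s_ge0 c11_ge0).
move=> x Xx g h fg rh; apply: le_affine_edist; rewrite ?sqrtr_ge0// => y y_min.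
rewrite (le_trans (BG x Xx g h fg rh))//.
rewrite -[leRHS]ger0_norm ?addr_ge0 ?mulr_ge0 ?sqrtr_ge0// -sqrtr_sqr.
apply: ler_wsqrtr.
rewrite (le_trans (cond_BG_growth BG_with Xx y_min.1 fg rh))//.
rewrite -(min_value_minimizer y_min) subrr mulr0 add0r.
have c12_2_ge0 : 0 <= 2 * c12 by rewrite mulr_ge0.
(* The gap at [y] is zero, and the square of the sum exceeds the sum of squares by a nonnegative
   cross term. *)
rewrite sqrrD exprMn (sqr_sqrtr cs_ge0) (sqr_sqrtr c12_2_ge0) lerD2r lerDl.
by rewrite mulrn_wge0// !mulr_ge0 ?sqrtr_ge0.
Qed.

Lemma cond_BAD_BG : global_quadratic_growth X (f \+ r) ->
  cond_BAD X rho eta f r -> cond_BG X rho eta f r.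
Proof.
move=> [kappa [kappa_gt0 growth]] [c9 [c10 [c9_ge0 c10_ge0 BAD]]].
(* From (a + b)^2 <= 2 a^2 + 2 b^2, followed by quadratic growth. *)
exists (2 * c9 ^+ 2 * kappa), (2 * c10 ^+ 2).
split=> [||x Xx g h fg rh].
  by rewrite !mulr_ge0 ?sqr_ge0// ltW.
  by rewrite mulr_ge0 ?sqr_ge0.
rewrite (le_trans (BAD x Xx g h fg rh))//.
have b_ge0 : 0 <= c9 * edist x (minimizers X (f \+ r)) + c10.
  by rewrite addr_ge0 ?mulr_ge0 ?edist_ge0.
rewrite -[leLHS]ger0_norm// -sqrtr_sqr; apply: ler_wsqrtr.
have := ler_wpM2l (sqr_ge0 c9) (growth x Xx).
by have := sqr_ge0 (c9 * edist x (minimizers X (f \+ r)) - c10); nra.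
Qed.

End BoundComparison.

Unset Implicit Arguments.
Set Strict Implicit.

(* The bound on lam is in the extended reals, where 0^-1 = +oo: it imposes
   nothing beyond 0 < lam when rho + eta = 0. *)
Theorem proposition3p3 (R : realType) (d : nat) (X : set 'rV[R]_d)
    (f r : 'rV[R]_d -> R) (rho eta lam : R)
    (X_closed : closed X) (X_convex : convex_set X)
    (f_lsc : lsc_on X f) (r_lsc : lsc_on X r)
    (argmin_neq0 : minimizers X (f \+ r) !=set0)
    (f_wcvx : weakly_convex X rho f) (r_wcvx : weakly_convex X eta r)
    (lam_gt0 : 0 < lam) (lam_lt : (lam%:E < ((rho + eta)%:E)^-1)%E) :
  [/\ (cond_BG X rho eta f r <-> cond_B3 X rho eta lam f r),
      ((cond_BAD X rho eta f r -> cond_B2 X rho eta f r) /\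
       (bounded_set (minimizers X (f \+ r)) ->
          cond_B2 X rho eta f r -> cond_BAD X rho eta f r)),
      (cond_BAD X rho eta f r -> cond_B6 X rho eta f r) &
      ((forall c11 c12 : R, cond_BG_with X rho eta f r c11 c12 ->
          cond_BAD_with X rho eta f r
            (Num.sqrt (c11 * (rho + eta + c11))) (Num.sqrt (2 * c12))) /\
       (global_quadratic_growth X (f \+ r) ->
          cond_BAD X rho eta f r -> cond_BG X rho eta f r))].
Proof.
have s_ge0 : 0 <= rho + eta.
  (* A negative [rho + eta] would have a negative inverse lying above [lam > 0]. *)
  rewrite leNgt; apply/negP => s_lt0; move: lam_lt; rewrite inver lt_eqF// lte_fin.
  by move=> /(lt_trans lam_gt0); rewrite invr_gt0 ltNge ltW.
split.
- by split; [exact: cond_BG_B3|exact: cond_B3_BG].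
- by split; [exact: cond_BAD_B2|exact: cond_B2_BAD].
- exact: cond_BAD_B6.
- by split=> [c11 c12|]; [exact: cond_BG_BAD|exact: cond_BAD_BG].
Qed.
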